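(* Let $K$ be finite dimensional and suppose there exists $c \ge 0$ such that the penalty function $\Phi_c(\cdot) = f_0(\cdot) + c \operatorname{dist}(F(\cdot), -K)$ is coercive on $Q$. Then for any compact subset $\mathscr{D}_0 \subseteq \mathscr{D}_s$ there exists $\mu_* \ge 0$ such that for all $\mu \ge \mu_*$ and for any $z \in \mathscr{D}_0$ and $v \in \partial h_0(z)$ there exists a globally optimal solution of the penalized problem \[ \min_{(x, s)} \ g_0(x) - \langle v, x \rangle + \mu \langle t_0, s \rangle \quad \text{subject to } G(x) - H(z) - D H(z)(x - z) \preceq_K s, \quad s \succeq_K 0, \quad x \in Q, \] and this problem is exact, in the sense that a pair $(x_*, s_* )$ is a solution of this problem if and only if $s_* = 0$ and $x_*$ is a solution of the corresponding non-penalized problem \[ \min_x \ g_0(x) - \langle v, x \rangle \quad \text{subject to } G(x) - H(z) - D H(z)(x - z) \preceq_K 0, \quad x \in Q. \]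
   Context: $g_0, h_0 \colon \mathbb{R}^d \to \mathbb{R}$ are real-valued closed convex functions, $f_0 = g_0 - h_0$; $\partial$ is the convex subdifferential. $Y$ is a real Banach space with dual $Y^*$, $K \subset Y$ is a proper cone (a closed convex cone with $K \cap (-K) = \{0\}$), $x \preceq_K y$ iff $y - x \in K$, $K^* = \{ y^* \in Y^* \mid \langle y^*, y \rangle \ge 0 \ \forall y \in K \}$. The maps $G, H \colon \mathbb{R}^d \to Y$ are $K$-convex ($G(\alpha x_1 + (1-\alpha)x_2) \preceq_K \alpha G(x_1) + (1-\alpha) G(x_2)$ for all $\alpha \in [0,1]$, $x_1,x_2\in\mathbb{R}^d$; similarly for $H$), $H$ is continuously Fréchet differentiable with derivative $DH$, $F = G - H$, and $Q \subseteq \mathbb{R}^d$ is a closed convex set. $t_0 \in Y^*$ is a fixed functional with $t_0 \succ_{K^*} 0$, meaning $t_0 \in K^*$ and $\langle t_0, y \rangle > 0$ for all $y \in K \setminus \{0\}$. $\mathscr{D}_s = \{ z \in Q \mid 0 \in \operatorname{int}\{ G(x) - H(z) - D H(z)(x - z) + K \mid x \in Q \} \}$, where the set inside $\operatorname{int}$ is the union over $x \in Q$ of the indicated translates of $K$. A function $\varphi \colon \mathbb{R}^d \to \mathbb{R}$ is coercive on $Q$ if $\varphi(x_n) \to +\infty$ for any sequence $\{x_n\} \subset Q$ with $\|x_n\| \to +\infty$. Solutions are understood as globally optimal solutions. *)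

(* Defs.v *)
From HB Require Import structures.
From mathcomp Require Import all_boot all_order all_algebra.
From mathcomp Require Import all_classical all_reals all_analysis.

Set Implicit Arguments.
Unset Strict Implicit.
Unset Printing Implicit Defensive.

Import Order.TTheory GRing.Theory Num.Theory.
Import numFieldNormedType.Exports.

Local Open Scope classical_set_scope.
Local Open Scope ring_scope.

(* R^d is 'rV[R]_d.  Its library norm is the sup norm; coercivity, compactness,
   closedness and Frechet differentiability do not depend on the choice of a
   norm on R^d.  The inner product is the Euclidean one. *)
Definition dotrv (R : realType) (d : nat) (v x : 'rV[R]_d) : R :=
  \sum_(i < d) v 0 i * x 0 i.

Definition closed_convex_fun (R : realType) (d : nat) (g : 'rV[R]_d -> R) :
    Prop :=
  convex_function setT g /\
  closed [set xr : 'rV[R]_d * R | g xr.1 <= xr.2].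

Definition subdifferential (R : realType) (d : nat) (h : 'rV[R]_d -> R)
    (z : 'rV[R]_d) : set 'rV[R]_d :=
  [set v | forall x, h z + dotrv v (x - z) <= h x].

Definition coercive_on (R : realType) (d : nat) (Q : set 'rV[R]_d)
    (phi : 'rV[R]_d -> R) : Prop :=
  forall u : nat -> 'rV[R]_d, (forall n, Q (u n)) ->
    (`|u n| @[n --> \oo] --> +oo) -> (phi (u n) @[n --> \oo] --> +oo).

Definition neg_set (V : zmodType) (A : set V) : set V := [set - y | y in A].

Definition proper_cone (R : realType) (Y : normedModType R) (K : set Y) :
    Prop :=
  [/\ closed K, convex_set K,
      forall (a : R) y, 0 <= a -> K y -> K (a *: y) &
      K `&` neg_set K = [set 0]].

Definition cone_le (V : zmodType) (K : set V) (x y : V) : Prop := K (y - x).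

(* K spans a finite-dimensional subspace of Y, although Y itself may be
   infinite dimensional. *)
Definition finite_dim_cone (R : realType) (Y : lmodType R) (K : set Y) : Prop :=
  exists (n : nat) (e : 'I_n -> Y),
    forall y, K y -> exists a : 'I_n -> R, y = \sum_(i < n) a i *: e i.

Definition cone_convex (R : realType) (d : nat) (Y : normedModType R)
    (K : set Y) (G : 'rV[R]_d -> Y) : Prop :=
  forall (a : R) (x1 x2 : 'rV[R]_d), 0 <= a -> a <= 1 ->
    cone_le K (G (a *: x1 + (1 - a) *: x2)) (a *: G x1 + (1 - a) *: G x2).

Definition dual_cone (R : realType) (Y : normedModType R) (K : set Y) :
    set {linear Y -> R} :=
  [set t : {linear Y -> R} | continuous t /\ forall y, K y -> 0 <= t y].

Definition dual_cone_gt0 (R : realType) (Y : normedModType R) (K : set Y)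
    (t : {linear Y -> R}) : Prop :=
  dual_cone K t /\ forall y, K y -> y <> 0 -> 0 < t y.

(* The second clause is continuity of z |-> 'd H z for the operator norm. *)
Definition continuously_frechet_diff (R : realType) (d : nat)
    (Y : normedModType R) (H : 'rV[R]_d -> Y) : Prop :=
  (forall z, differentiable H z) /\
  (forall (z : 'rV[R]_d) (eps : R), 0 < eps ->
    \forall w \near z, forall u : 'rV[R]_d,
      `|'d H w u - 'd H z u| <= eps * `|u|).

Definition dist_set (R : realType) (Y : normedModType R) (y : Y) (A : set Y) :
    R :=
  inf [set `|y - a| | a in A].

Definition lin_map (R : realType) (d : nat) (Y : normedModType R)
    (G H : 'rV[R]_d -> Y) (z x : 'rV[R]_d) : Y :=
  G x - H z - 'd H z (x - z).

Definition slater_set (R : realType) (d : nat) (Y : normedModType R)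
    (K : set Y) (Q : set 'rV[R]_d) (G H : 'rV[R]_d -> Y) : set 'rV[R]_d :=
  [set z | Q z /\
    interior (\bigcup_(x in Q) [set lin_map G H z x + k | k in K]) 0].

Definition penalty_fun (R : realType) (d : nat) (Y : normedModType R)
    (K : set Y) (f0 : 'rV[R]_d -> R) (F : 'rV[R]_d -> Y) (c : R)
    (x : 'rV[R]_d) : R :=
  f0 x + c * dist_set (F x) (neg_set K).

Definition global_solution (R : realType) (T : Type) (A : set T) (f : T -> R)
    (x : T) : Prop :=
  A x /\ forall y, A y -> f x <= f y.

Definition subproblem_feasible (R : realType) (d : nat) (Y : normedModType R)
    (K : set Y) (Q : set 'rV[R]_d) (G H : 'rV[R]_d -> Y) (z : 'rV[R]_d) :
    set 'rV[R]_d :=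
  [set x | cone_le K (lin_map G H z x) 0 /\ Q x].

Definition subproblem_obj (R : realType) (d : nat) (g0 : 'rV[R]_d -> R)
    (v x : 'rV[R]_d) : R :=
  g0 x - dotrv v x.

Definition penalized_feasible (R : realType) (d : nat) (Y : normedModType R)
    (K : set Y) (Q : set 'rV[R]_d) (G H : 'rV[R]_d -> Y) (z : 'rV[R]_d) :
    set ('rV[R]_d * Y) :=
  [set xs | [/\ cone_le K (lin_map G H z xs.1) xs.2, cone_le K 0 xs.2 &
                Q xs.1]].

Definition penalized_obj (R : realType) (d : nat) (Y : normedModType R)
    (g0 : 'rV[R]_d -> R) (t0 : {linear Y -> R}) (v : 'rV[R]_d) (mu : R)
    (xs : 'rV[R]_d * Y) : R :=
  g0 xs.1 - dotrv v xs.1 + mu * t0 xs.2.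

(* Main.v *)
(* The map z |-> lin_map G H z x varies only inside K - K, because the
   remainder H x - H z - DH(z)(x - z) of a K-convex map lies in K.  Hence a
   Slater point at z0 that is feasible with margin in a direction e of the
   relative interior of K remains so, with the same point, for all z near z0;
   no open mapping argument is needed.  Moving from (x, s) towards this point
   by the fraction |s| / (theta + |s|) removes the slack s, and the increase of
   the convex objective is linear in |s|: the objective is bounded below along
   the slack by the coercive penalty function, since dist(F x, -K) <= |s| and
   v is a subgradient of h0.  As t0 >= kappa |.| on the finite-dimensional cone
   K, a large mu makes the move profitable, locally uniformly in z, and hence
   uniformly on the compact set. *)
Require Import Defs.
From HB Require Import structures.
From mathcomp Require Import all_boot all_order all_algebra.
From mathcomp Require Import all_classical all_reals all_analysis.
From mathcomp Require Import lra ring.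

Set Implicit Arguments.
Unset Strict Implicit.
Unset Printing Implicit Defensive.

Import Order.TTheory GRing.Theory Num.Theory.
Import numFieldNormedType.Exports.

Local Open Scope classical_set_scope.
Local Open Scope ring_scope.

(** * Closure properties of proper cones *)

Lemma convex_set_comb (R : realType) (M : lmodType R) (A : set M) (a : R) x y :
  convex_set A -> 0 <= a -> a <= 1 -> A x -> A y ->
  A (a *: x + (1 - a) *: y).
Proof.
move=> cA a0 a1 Ax Ay.
have := cA x y (Itv01 a0 a1).
by rewrite !inE; exact.
Qed.

Lemma cone_add (R : realType) (Y : normedModType R) (K : set Y) x y :
  proper_cone K -> K x -> K y -> K (x + y).
Proof.
move=> [_ cK sK _] Kx Ky.
have h : (1 - 2^-1 : R) = 2^-1 by lra.
have /(sK 2 _) : K (2^-1 *: x + (1 - 2^-1) *: y) by apply: convex_set_comb => //; lra.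
by rewrite h -scalerDr scalerA divff ?pnatr_eq0// scale1r; apply; lra.
Qed.

Lemma cone0 (R : realType) (Y : normedModType R) (K : set Y) :
  proper_cone K -> K 0.
Proof. by case=> _ _ _ h; have : [set (0 : Y)] 0 by []; rewrite -h => -[]. Qed.

Lemma cone_scale (R : realType) (Y : normedModType R) (K : set Y) (a : R) y :
  proper_cone K -> 0 <= a -> K y -> K (a *: y).
Proof. by case=> _ _ h _; exact: h. Qed.

Lemma cone_sum (R : realType) (Y : normedModType R) (K : set Y) (I : finType)
    (F : I -> Y) :
  proper_cone K -> (forall i, K (F i)) -> K (\sum_i F i).
Proof.
move=> hK hF; apply: big_ind => //; first exact: cone0.
by move=> x y; exact: cone_add.
Qed.

(** * Bases of a finite-dimensional cone *)

(** Coefficients form a row vector, so that the norm, rank and compactness results for row vectors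
    apply to them. *)
Definition lincomb (R : realType) (Y : lmodType R) (m : nat) (k : 'I_m -> Y)
  (a : 'rV[R]_m) : Y := \sum_j a 0 j *: k j.

Lemma lincombD (R : realType) (Y : lmodType R) (m : nat) (k : 'I_m -> Y) a b :
  lincomb k (a + b) = lincomb k a + lincomb k b.
Proof.
by rewrite /lincomb -big_split; apply: eq_bigr => j _; rewrite mxE scalerDl.
Qed.

Lemma lincombZ (R : realType) (Y : lmodType R) (m : nat) (k : 'I_m -> Y) c a :
  lincomb k (c *: a) = c *: lincomb k a.
Proof.
by rewrite /lincomb scaler_sumr; apply: eq_bigr => j _; rewrite mxE scalerA.
Qed.

Lemma lincomb0 (R : realType) (Y : lmodType R) (m : nat) (k : 'I_m -> Y) :
  lincomb k 0 = 0.
Proof. by apply: big1 => j _; rewrite mxE scale0r. Qed.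

Lemma lincomb_continuous (R : realType) (Y : normedModType R) (m : nat)
  (k : 'I_m -> Y) : continuous (lincomb k).
Proof.
suff H s : continuous (fun x : 'rV[R]_m => \sum_(j <- s) x 0 j *: k j).
  exact: H.
elim: s => [|j s IH] a.
  under eq_fun do rewrite big_nil; exact: cst_continuous.
under eq_fun do rewrite big_cons.
have h : (x : 'rV[R]_m) 0 j @[x --> a] --> a 0 j by exact: coord_continuous.
exact: (cvgD (cvgZr_tmp (a := k j) h) (IH a)).
Qed.

Definition lin_indep (R : realType) (Y : lmodType R) (m : nat) (k : 'I_m -> Y)
  := forall a : 'rV[R]_m, lincomb k a = 0 -> a = 0.

(** The matrix of [k] over [e] has trivial left kernel, because a row of the kernel gives a
    vanishing combination of [k]. Its rank is therefore [m], which is at most [n]. *)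
Lemma lin_indep_size (R : realType) (Y : lmodType R) (m n : nat)
    (k : 'I_m -> Y) (e : 'I_n -> Y) :
  (forall j, exists a : 'I_n -> R, k j = \sum_i a i *: e i) ->
  lin_indep k -> (m <= n)%N.
Proof.
move=> /choice[a ka] hk; rewrite leqNgt; apply/negP => nm.
pose A : 'M[R]_(m, n) := \matrix_(j, i) a j i.
suff : row_free A by rewrite /row_free => /eqP rA; move: (rank_leq_col A); rewrite rA leqNgt nm.
rewrite -kermx_eq0; apply/eqP/row_matrixP => i; rewrite row0.
apply: hk; rewrite /lincomb.
under eq_bigr => j _ do rewrite ka scaler_sumr.
rewrite exchange_big /= big1// => l _.
under eq_bigr => j _ do rewrite scalerA.
rewrite -scaler_suml.
have := mulmx_ker A; move=> /matrixP /(_ i l); rewrite !mxE.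
under eq_bigr => j _ do rewrite [A _ _]mxE.
by under [in X in _ -> X]eq_bigr => j _ do rewrite [row _ _ _ _]mxE; move=> ->; rewrite scale0r.
Qed.

(** A linearly independent family in [K] of maximal size spans [K], since a vector outside its span
    could be adjoined. With the basis drawn from [K] itself, nonnegative coordinates imply
    membership in a proper cone [K]. *)
Lemma cone_basis (R : realType) (Y : lmodType R) (K : set Y) :
  finite_dim_cone K ->
  exists (m : nat) (k : 'I_m -> Y),
    [/\ forall j, K (k j), lin_indep k &
        forall y, K y -> exists a, y = lincomb k a].
Proof.
move=> [n [e he]].
pose P m := `[< exists k : 'I_m -> Y, (forall j, K (k j)) /\ lin_indep k >].
have P0 : P 0%N.
  by apply/asboolP; exists (fun=> 0); split=> [[]//|a _]; apply/rowP => -[].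
have Pn m : P m -> (m <= n)%N.
  by move=> /asboolP[k [kK kli]]; apply: (lin_indep_size _ kli) => j; exact/he/kK.
case: (ex_maxnP (ex_intro (fun i => P i) 0%N P0) Pn) => m /asboolP[k [kK kli]] mmax.
exists m, k; split => // y Ky; apply: contrapT => ny.
suff /mmax : P m.+1 by rewrite ltnn.
apply/asboolP; exists (fun i => if unlift ord0 i is Some j then k j else y).
split=> [i|a]; first by case: unliftP.
rewrite /lincomb big_ord_recl unlift_none.
under eq_bigr => j _ do rewrite liftK.
pose b : 'rV[R]_m := \row_j a 0 (lift ord0 j).
have -> : \sum_(i < m) a 0 (lift ord0 i) *: k i = lincomb k b.
  by apply: eq_bigr => j _; rewrite mxE.
(* If [y] has coefficient zero, independence of [k] applies; otherwise the relation can be solved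
   for [y], contradicting [ny]. *)
have [a0|a0] := eqVneq (a 0 ord0) 0.
  rewrite a0 scale0r add0r => /kli /rowP hb.
  apply/rowP => i; rewrite mxE; case: (unliftP ord0 i) => [j ->|->//].
  by move: (hb j); rewrite !mxE.
move=> /eqP; rewrite addr_eq0 => /eqP h; exfalso; apply: ny.
exists (- (a 0 ord0)^-1 *: b); rewrite lincombZ scaleNr -scalerN -h.
by rewrite scalerA mulVf// scale1r.
Qed.

(** * Compactness of the unit sphere and its consequences for the cone *)

Lemma sphere_lower_bound (R : realType) (m : nat) (C : set 'rV[R]_m)
    (f : 'rV[R]_m -> R) :
  closed C -> continuous f -> (forall a, C a -> `|a| = 1 -> 0 < f a) ->
  exists2 c : R, 0 < c & forall a, C a -> `|a| = 1 -> c <= f a.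
Proof.
move=> clC cf fpos.
pose A := C `&` [set a : 'rV[R]_m | `|a| = 1].
(* When no point of [C] has norm 1, any positive constant serves. *)
have [[a0 Aa0]|nA] := pselect (A !=set0); last first.
  by exists 1 => // a Ca a1; exfalso; apply: nA; exists a.
have cA : compact A.
  apply: bounded_closed_compact.
    by exists 1; split=> // M M1 a [_ /= ->]; exact: ltW.
  apply: closedI => //.
  apply: (@closed_comp _ _ (fun a : 'rV[R]_m => `|a|) [set 1]).
    by move=> x _; exact: norm_continuous.
  exact: closed_eq.
have [|c cA' cmin] := EVT_min_rV (ex_intro _ _ Aa0) cA (f := f).
  exact: continuous_subspaceT.
move: cA'; rewrite inE => -[Cc c1].
exists (f c); first exact: fpos.
by move=> a Ca a1; apply: cmin; rewrite inE.
Qed.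

Lemma row_normalize (R : realType) (m : nat) (a : 'rV[R]_m) : a != 0 ->
  `| `|a|^-1 *: a| = 1.
Proof.
by move=> a0; rewrite normrZ normfV normr_id mulVf// normr_eq0.
Qed.

Lemma row_coord_le_norm (R : realType) (m : nat) (a : 'rV[R]_m) j :
  `|a 0 j| <= `|a|.
Proof.
rewrite [leRHS]/Num.norm /= mx_normrE.
by apply: (@le_bigmax _ _ _ 0 (fun ij => `|a ij.1 ij.2|) (0, j)).
Qed.

Lemma lincomb_norm_le (R : realType) (Y : normedModType R) (m : nat)
    (k : 'I_m -> Y) a : `|lincomb k a| <= `|a| * \sum_j `|k j|.
Proof.
rewrite mulr_sumr; apply: le_trans (ler_norm_sum _ _ _) _.
apply: ler_sum => j _; rewrite normrZ ler_wpM2r//; exact: row_coord_le_norm.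
Qed.

(** Both sides are positively homogeneous, so it suffices to bound [t] below on the compact set of
    unit coordinate vectors whose combination lies in [K]; independence of the basis keeps these
    combinations nonzero. *)
Lemma dual_cone_gt0_coercive (R : realType) (Y : normedModType R) (K : set Y)
    (t : {linear Y -> R}) :
  proper_cone K -> finite_dim_cone K -> dual_cone_gt0 K t ->
  exists2 c : R, 0 < c & forall y, K y -> c * `|y| <= t y.
Proof.
move=> hK /cone_basis[m [k [kK kli kspan]]] [[ct _] tpos].
have [] := @sphere_lower_bound R m (lincomb k @^-1` K) (t \o lincomb k).
- apply: closed_comp => [x _|]; first exact: lincomb_continuous.
  by case: hK.
- by move=> a; apply: continuous_comp; [exact: lincomb_continuous|exact: ct].
- move=> a /= Ka a1; apply: tpos => // /kli a0.
  by move: a1; rewrite a0 normr0 => /esym/eqP; rewrite oner_eq0.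
(* [B] compares the norm of [Y] with that of the coordinates; the [+ 1] keeps it positive for an
   empty basis. *)
move=> c c0 hc; pose B := \sum_j `|k j| + 1.
have B0 : 0 < B by rewrite ltr_wpDl// sumr_ge0.
exists (c / B); first exact: divr_gt0.
move=> y Ky; have [a ya] := kspan _ Ky.
have [a0|a0] := eqVneq a 0.
  by rewrite ya a0 lincomb0 normr0 mulr0 linear0.
have an0 : 0 < `|a| by rewrite normr_gt0.
have /= := hc (`|a|^-1 *: a).
rewrite lincombZ -ya linearZ /= => h.
have {}h : c <= `|a|^-1 * t y.
  by apply: h; [apply: cone_scale => //; rewrite invr_ge0|exact: row_normalize].
rewrite mulrAC ler_pdivrMr//.
have yB : `|y| <= `|a| * B.
  by rewrite ya; apply: le_trans (lincomb_norm_le _ _) _; rewrite ler_pM2l// lerDl.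
apply: le_trans (ler_wpM2l (ltW c0) yB) _.
rewrite mulrA ler_pM2r//.
by move: h; rewrite mulrC ler_pdivlMr.
Qed.

(* The point [e] is in the interior of [K] relative to its span [K - K]. *)
Lemma cone_relative_interior (R : realType) (Y : normedModType R) (K : set Y) :
  proper_cone K -> finite_dim_cone K ->
  exists (e : Y) (r : R), [/\ K e, 0 < r &
    forall x y, K x -> K y -> `|x - y| <= r -> K (e + (x - y))].
Proof.
move=> hK /cone_basis[m [k [kK kli kspan]]].
have [] := @sphere_lower_bound R m setT (fun a => `|lincomb k a|).
- exact: closedT.
- by move=> a; apply: continuous_comp; [exact: lincomb_continuous|exact: norm_continuous].
- move=> a _ a1; rewrite normr_gt0; apply/eqP => /kli a0.
  by move: a1; rewrite a0 normr0 => /esym/eqP; rewrite oner_eq0.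
(* The point is the sum of the basis. A vector of the span of norm at most [c] has coordinates in
   [-1, 1], so adding it leaves all coordinates nonnegative. *)
move=> c c0 hc; exists (\sum_j k j), c; split => //; first exact: cone_sum.
move=> x y Kx Ky; have [a xa] := kspan _ Kx; have [b yb] := kspan _ Ky.
have -> : x - y = lincomb k (a - b).
  by rewrite lincombD -(scaleN1r b) lincombZ scaleN1r -xa -yb.
set u := a - b => uc.
have u1 : `|u| <= 1.
  have [->|u0] := eqVneq u 0; first by rewrite normr0.
  have un0 : 0 < `|u| by rewrite normr_gt0.
  have := hc (`|u|^-1 *: u) I (row_normalize u0).
  rewrite lincombZ normrZ normfV normr_id mulrC ler_pdivlMr// => h.
  by rewrite -(ler_pM2l c0) mulr1 (le_trans h).
rewrite /lincomb -big_split /=; apply: cone_sum => // j.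
rewrite -{1}[k j]scale1r -scalerDl; apply: cone_scale => //.
have := le_trans (row_coord_le_norm u j) u1.
by rewrite ler_norml => /andP[+ _]; rewrite -subr_ge0 opprK addrC.
Qed.

(** * Continuity of cone-convex maps *)

Section ConeConvexContinuity.
Variables (R : realType) (d : nat) (Y : normedModType R) (K : set Y).
Variables (L : 'rV[R]_d -> Y) (x : 'rV[R]_d).
Hypotheses (hK : proper_cone K) (hL : cone_convex K L).

Let W (h : 'rV[R]_d) := L (x + h) - L x.

Let W0 : W 0 = 0. Proof. by rewrite /W addr0 subrr. Qed.

Let W_convex (a : R) h h' : 0 <= a -> a <= 1 ->
  K (a *: W h + (1 - a) *: W h' - W (a *: h + (1 - a) *: h')).
Proof.
move=> a0 a1; have := hL (x + h) (x + h') a0 a1; rewrite /cone_le.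
have -> : a *: (x + h) + (1 - a) *: (x + h') = x + (a *: h + (1 - a) *: h').
  by rewrite !scalerDr addrACA -scalerDl subrKC scale1r.
set z := x + _; rewrite /W -/z; congr K.
rewrite !scalerBr opprB [X in _ = X + _]addrACA -opprD -scalerDl subrKC scale1r.
by rewrite -[RHS]addrA addKr.
Qed.

Let W_scale (a : R) h : 0 <= a -> a <= 1 -> K (a *: W h - W (a *: h)).
Proof.
by move=> a0 a1; have := W_convex h 0 a0 a1; rewrite W0 !scaler0 !addr0.
Qed.

Let W_half h h' :
  K (2^-1 *: W h + 2^-1 *: W h' - W (2^-1 *: h + 2^-1 *: h')).
Proof.
have e : 1 - 2^-1 = 2^-1 :> R by lra.
by have := @W_convex 2^-1 h h'; rewrite e; apply; lra.
Qed.

(** The two coefficients are the positive and negative parts of [a], which makes the bound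
    continuous in [a] across both rays. *)
Let W_ray (a : R) h : `|a| <= 1 ->
  K (((`|a| + a) / 2) *: W h + ((`|a| - a) / 2) *: W (- h) - W (a *: h)).
Proof.
move=> a1; have [a0|/ltW a0] := leP 0 a.
  rewrite ger0_norm// subrr mul0r scale0r addr0.
  have -> : (a + a) / 2 = a by field.
  by apply: W_scale => //; rewrite ger0_norm in a1.
rewrite ler0_norm// in a1 *; rewrite addNr mul0r scale0r add0r.
have -> : (- a - a) / 2 = - a by field.
have -> : a *: h = (- a) *: (- h) by rewrite scaleNr scalerN opprK.
by apply: W_scale; rewrite ?oppr_ge0.
Qed.

(** Induction on the coordinates: the sum is the midpoint of its doubled first term, bounded by
    [W_ray], and of its doubled remainder, bounded by the induction hypothesis. Each doubling of the
    argument halves the admissible radius. *)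
Let W_majorant (s : seq 'I_d) : exists U : 'rV[R]_d -> Y,
  [/\ continuous U, U 0 = 0 & forall h, `|h| <= 2^-1 ^+ size s ->
    K (U h - W (\sum_(i <- s) h 0 i *: delta_mx 0 i))].
Proof.
elim: s => [|i s [U [Uc U0 hU]]].
  exists (fun=> 0); split=> // [|h _]; first exact: cst_continuous.
  by rewrite big_nil W0 subr0; exact: cone0.
pose X (h : 'rV[R]_d) :=
  ((`|2 * h 0 i| + 2 * h 0 i) / 2) *: W (delta_mx 0 i) +
  ((`|2 * h 0 i| - 2 * h 0 i) / 2) *: W (- delta_mx 0 i).
exists (fun h => 2^-1 *: X h + 2^-1 *: U (2 *: h)); split.
- move=> a; have FF : Filter (nbhs a) by exact: nbhs_filter.
  have hi : {for a, continuous (fun h : 'rV[R]_d => 2 * h 0 i)}.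
    by have /(cvgMr (a := 2)) := @coord_continuous R 1 d 0 i a.
  have ni : {for a, continuous (fun h : 'rV[R]_d => `|2 * h 0 i|)} by exact: cvg_norm hi.
  have Xc : {for a, continuous X}.
    refine (cvgD (cvgZr_tmp (a := W (delta_mx 0 i)) (cvgMl (b := 2^-1) (cvgD ni hi)))
      (cvgZr_tmp (a := W (- delta_mx 0 i)) (cvgMl (b := 2^-1) (cvgB ni hi)))).
  have U2 : {for a, continuous (fun h : 'rV[R]_d => U (2 *: h))}.
    by apply: continuous_comp; [exact: scaler_continuous|exact: Uc].
  exact: (cvgD (cvgZl_tmp (k := 2^-1) Xc) (cvgZl_tmp (k := 2^-1) U2)).
- by rewrite /X !mxE mulr0 normr0 subr0 addr0 mul0r !scale0r scaler0 U0 scaler0 !addr0 scaler0.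
move=> h; rewrite /= exprS => hh.
have hs : `|2 *: h| <= 2^-1 ^+ size s.
  rewrite normrZ ger0_norm//.
  by move: hh; rewrite mulrC ler_pdivlMr// mulrC.
have h2 : `|2 * h 0 i| <= 1.
  apply: (@le_trans _ _ `|2 *: h|).
    by have := row_coord_le_norm (2 *: h) i; rewrite mxE.
  by apply: le_trans hs _; apply: exprn_ile1; lra.
have i2 : (0 : R) <= 2^-1 by lra.
have := cone_add hK (cone_add hK
  (cone_scale hK i2 (W_ray (delta_mx 0 i) h2))
  (cone_scale hK i2 (hU _ hs)))
  (W_half ((2 * h 0 i) *: delta_mx 0 i) (\sum_(j <- s) (2 *: h) 0 j *: delta_mx 0 j)).
rewrite -/(X h) !scalerBr big_cons.
have -> : 2^-1 *: ((2 * h 0 i) *: delta_mx 0 i) +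
    2^-1 *: (\sum_(j <- s) (2 *: h) 0 j *: delta_mx 0 j) =
    h 0 i *: delta_mx 0 i + \sum_(j <- s) h 0 j *: delta_mx 0 j :> 'rV[R]_d.
  rewrite scalerA mulrA mulVf// mul1r scaler_sumr; congr (_ + _).
  by apply: eq_bigr => j _; rewrite mxE !scalerA mulrA mulVf// mul1r.
rewrite (addrACA (2^-1 *: X h)) -opprD addrA subrK; exact.
Qed.

(* Midpoint convexity turns the majorant [U] of the increment [W] of [L] at [x]
   into the minorant [h |-> - U (- h)]. *)
Lemma cone_convex_continuous_at (t : {linear Y -> R}) (c : R) :
  continuous t -> 0 < c -> (forall y, K y -> c * `|y| <= t y) ->
  {for x, continuous L}.
Proof.
move=> ct c0 hc; have [U [Uc U0 hU]] := W_majorant (index_enum 'I_d).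
(* The vector on the left lies in [K], where [t] controls the norm, and [t] can only grow when [W h]
   is replaced by [U h]. *)
have key h : `|h| <= 2^-1 ^+ size (index_enum 'I_d) ->
    `|W h + U (- h)| <= c^-1 * t (U h + U (- h)).
  move=> hh.
  have Uh : K (U h - W h) by rewrite {2}[h]row_sum_delta; exact: hU.
  have UNh : K (U (- h) - W (- h)).
    by rewrite {2}[- h]row_sum_delta; apply: hU; rewrite normrN.
  have mid : K (W h + W (- h)).
    have /(cone_scale hK (ler0n R 2)) := W_half h (- h).
    by rewrite -!scalerDr subrr scaler0 W0 subr0 scalerA mulfV// scale1r.
  rewrite mulrC ler_pdivlMr// mulrC.
  have h1 : K (W h + U (- h)).
    by have := cone_add hK mid UNh; rewrite -addrA (addrC (W (- h))) subrK.
  apply: le_trans (hc _ h1) _.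
  rewrite -subr_ge0 -linearB.
  have -> : U h + U (- h) - (W h + U (- h)) = U h - W h.
    by rewrite opprD addrACA subrr addr0.
  by apply: le_trans (hc _ Uh); rewrite mulr_ge0// ltW.
(* [f] is continuous at [x], vanishes there, and dominates the norm of [L x - L y] for [y] near
   [x]. *)
pose f (y : 'rV[R]_d) := c^-1 * t (U (y - x) + U (x - y)) + `|U (x - y)|.
have fc : {for x, continuous f}.
  have c1 : {for x, continuous (fun y : 'rV[R]_d => U (y - x))}.
    apply: continuous_comp; last exact: Uc.
    exact: (cvgB (@cvg_id _ (nbhs x)) (cvg_cst x)).
  have c2 : {for x, continuous (fun y : 'rV[R]_d => U (x - y))}.
    apply: continuous_comp; last exact: Uc.
    exact: (cvgB (cvg_cst x) (@cvg_id _ (nbhs x))).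
  apply: (cvgD _ (cvg_norm c2)); apply: cvgMr.
  exact: (cvg_comp _ t (cvgD c1 c2) (ct _)).
have fx : f x = 0 by rewrite /f subrr U0 addr0 linear0 mulr0 normr0 addr0.
apply/(@cvgrPdist_le _ _ _ (nbhs x)) => eps eps0.
have fe : \forall y \near x, `|f y| <= eps.
  near=> y; rewrite -normrN -[- f y]add0r -fx.
  by near: y; exact: (cvgr_dist_le f (f x) fc _ eps0).
have d0 : 0 < 2^-1 ^+ size (index_enum 'I_d) :> R by rewrite exprn_gt0.
near=> y.
have yx : `|y - x| <= 2^-1 ^+ size (index_enum 'I_d).
  rewrite distrC; near: y; exact: (@cvgr_dist_le _ _ _ _ (nbhs_filter x) id x cvg_id _ d0).
have -> : L x - L y = U (x - y) - (W (y - x) + U (- (y - x))).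
  by rewrite opprB opprD addrCA subrr addr0 /W subrKC opprB.
apply: le_trans (ler_normB _ _) _; rewrite addrC.
apply: (@le_trans _ _ (f y)).
  by rewrite lerD2r; apply: le_trans (key _ yx) _; rewrite opprB.
apply: le_trans (ler_norm _) _.
near: y; exact: fe.
Unshelve. all: by end_near. Qed.

End ConeConvexContinuity.

(** Provides the continuity of [G], from which the feasible set of the subproblem is seen to be
    closed. *)
Lemma cone_convex_continuous (R : realType) (d : nat) (Y : normedModType R)
    (K : set Y) (L : 'rV[R]_d -> Y) (t : {linear Y -> R}) :
  proper_cone K -> finite_dim_cone K -> dual_cone_gt0 K t ->
  cone_convex K L -> continuous L.
Proof.
move=> hK hfin ht hL x.
have [c c0 hc] := dual_cone_gt0_coercive hK hfin ht.
by apply: cone_convex_continuous_at hL _ _ _ c0 hc => //; case: ht => -[].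
Qed.

Lemma convex_function_comb (R : realType) (d : nat) (g : 'rV[R]_d -> R)
    (a : R) x y : convex_function setT g -> 0 <= a -> a <= 1 ->
  g (a *: x + (1 - a) *: y) <= a * g x + (1 - a) * g y.
Proof.
move=> cg a0 a1; have := cg (Itv01 a0 a1) x y.
by rewrite !inE => /(_ I I).
Qed.

(** The case [Y = R] with the nonnegative half-line as cone, the identity as [t], and [c = 1]. *)
Lemma convex_function_continuous (R : realType) (d : nat) (g : 'rV[R]_d -> R) :
  convex_function setT g -> continuous g.
Proof.
move=> cg x.
pose K : set R := [set y | 0 <= y].
have hK : proper_cone K.
  split; first exact: closed_ge.
  - move=> a b l /set_mem a0 /set_mem b0; apply/mem_set; rewrite /K /=.
    by apply: addr_ge0; apply: mulr_ge0; rewrite ?subr_ge0 ?ge0 ?le1.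
  - by move=> a y a0 y0; exact: mulr_ge0.
  - apply/seteqP; split=> [y [/= y0 [z /= z0 zy]]|y /= ->].
      by apply/eqP; rewrite eq_le y0 -zy oppr_le0 z0.
    have K0 : K 0 by exact: lexx.
    by split=> //; exists 0 => //; exact: oppr0.
apply: (@cone_convex_continuous_at R d R K g x hK _ idfun 1) => //.
- move=> a y z a0 a1; rewrite /cone_le /K /= subr_ge0.
  exact: convex_function_comb.
- by move=> y; exact: cvg_id.
- by move=> y y0; rewrite mul1r ger0_norm.
Qed.

(** * The gradient inequality in the order of the cone *)

(** For 0 < h <= 1, convexity puts the difference quotient of [H] at [z] along [x - z] below
    [H x - H z]; the inequality survives the limit from the right because [K] is closed. *)
Lemma cone_convex_gradient (R : realType) (d : nat) (Y : normedModType R)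
    (K : set Y) (H : 'rV[R]_d -> Y) (z x : 'rV[R]_d) :
  proper_cone K -> cone_convex K H -> differentiable H z ->
  K (H x - H z - 'd H z (x - z)).
Proof.
move=> hK hH dH.
have cd : (fun h : R => h^-1 *: ((H \o shift z) (h *: (x - z)) - H z)) @ 0^'+ -->
    'd H z (x - z).
  apply: cvg_dnbhs_at_right; rewrite -deriveE//; exact: diff_derivable.
apply: (closed_cvg K _ _ _ (cvgB (cvg_cst (H x - H z)) cd)); first by case: hK.
near=> h.
have h0 : 0 < h by near: h; exact: nbhs_right_gt.
have h1 : h <= 1 by near: h; exact: nbhs_right_le.
have := cone_scale hK (_ : 0 <= h^-1) (hH h x z (ltW h0) h1).
rewrite invr_ge0 => /(_ (ltW h0)).
have -> : h *: x + (1 - h) *: z = h *: (x - z) + z.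
  by rewrite scalerBl scale1r scalerBr addrA addrAC.
rewrite /cone_le /=; set w := H (_ + z).
have -> : h *: H x + (1 - h) *: H z - w = h *: (H x - H z) - (w - H z).
  rewrite scalerBl scale1r scalerBr opprB [RHS]addrA; congr (_ - _).
  by rewrite addrA addrAC.
by rewrite scalerBr scalerA mulVf ?gt_eqF// scale1r.
Unshelve. all: by end_near. Qed.

(** * Distance, coercivity and existence of minimizers *)

Lemma dist_set_ge0 (R : realType) (Y : normedModType R) (y : Y) (A : set Y) :
  0 <= dist_set y A.
Proof.
(* The infimum of the empty set is 0 by convention. *)
have [A0|A0] := pselect (A !=set0); last first.
  have -> : A = set0 by apply/seteqP; split=> // a Aa; apply: A0; exists a.
  by rewrite /dist_set image_set0 inf0.
by apply: lb_le_inf; [exact: image_nonempty|move=> _ [b _ <-]].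
Qed.

Lemma dist_set_le (R : realType) (Y : normedModType R) (y a : Y) (A : set Y) :
  A a -> dist_set y A <= `|y - a|.
Proof.
move=> Aa; apply: ge_inf; last by exists a.
by exists 0 => _ [b _ <-].
Qed.

Lemma coercive_on_bounded (R : realType) (d : nat) (Q : set 'rV[R]_d)
    (phi : 'rV[R]_d -> R) (M : R) : coercive_on Q phi ->
  exists r, forall x, Q x -> phi x <= M -> `|x| <= r.
Proof.
move=> hphi; apply: contrapT => /forallNP h.
have /choice[u hu] : forall n : nat, exists x, [/\ Q x, phi x <= M & n%:R < `|x|].
  move=> n; have /existsNP[x /not_implyP[Qx /not_implyP[xM /negP xn]]] := h n%:R.
  by exists x; split=> //; rewrite ltNge.
have /cvgryPge/(_ (M + 1)) : phi (u n) @[n --> \oo] --> +oo.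
  apply: hphi => [n|]; first by case: (hu n).
  apply/cvgryPge => B; near=> n; have [_ _ /ltW] := hu n; apply: le_trans.
  by near: n; exact: nbhs_infty_ger.
move=> /filter_ex[n]; have [_ uM _] := hu n.
by move=> /le_trans /(_ uM); rewrite gerDl ler10.
Unshelve. all: by end_near. Qed.

(** The extreme value theorem applies on the sublevel set of [x0]; points of [S] outside it have
    larger values. *)
Lemma coercive_minimum (R : realType) (d : nat) (S : set 'rV[R]_d)
    (phi : 'rV[R]_d -> R) (x0 : 'rV[R]_d) (r : R) :
  closed S -> continuous phi -> S x0 ->
  (forall x, S x -> phi x <= phi x0 -> `|x| <= r) ->
  exists x, global_solution S phi x.
Proof.
move=> clS cphi Sx0 hr.
pose A := S `&` [set x | phi x <= phi x0].
have Ax0 : A x0 by split=> //=.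
have cA : compact A.
  apply: bounded_closed_compact.
    exists r; split; first exact: num_real.
    by move=> M rM x [Sx xx0]; exact: le_trans (hr _ Sx xx0) (ltW rM).
  apply: closedI => //.
  apply: (@closed_comp _ _ phi [set y | y <= phi x0]); last exact: closed_le.
  by move=> x _; exact: cphi.
have [|x /set_mem[Sx xx0] xmin] := EVT_min_rV (ex_intro _ _ Ax0) cA (f := phi).
  exact: continuous_subspaceT.
exists x; split=> // y Sy; have [yx0|/ltW yx0] := leP (phi y) (phi x0).
  by apply: xmin; exact/mem_set.
exact: le_trans xx0 yx0.
Qed.

Lemma continuous_lower_bound (R : realType) (d : nat) (f : 'rV[R]_d -> R)
    (r : R) :
  continuous f -> exists m, forall x, `|x| <= r -> m <= f x.
Proof.
move=> cf; pose A := [set x : 'rV[R]_d | `|x| <= `|r|].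
have A0 : A !=set0 by exists 0; rewrite /A /= normr0.
have cA : compact A.
  apply: bounded_closed_compact.
    by exists `|r|; split=> // M rM x /le_trans; apply; exact: ltW.
  apply: (@closed_comp _ _ (fun a : 'rV[R]_d => `|a|) [set y | y <= `|r|]).
    by move=> x _; exact: norm_continuous.
  exact: closed_le.
have [|x _ xmin] := EVT_min_rV A0 cA (f := f); first exact: continuous_subspaceT.
exists (f x) => y yr; apply: xmin; apply/mem_set; rewrite /A /=.
exact: le_trans yr (ler_norm _).
Qed.

(** Where the penalty function is at most 0, coercivity bounds [x], so [f0] is bounded below and the
    distance term is nonnegative; elsewhere 0 is a lower bound. *)
Lemma penalty_fun_lower_bound (R : realType) (d : nat) (Y : normedModType R)
    (K : set Y) (Q : set 'rV[R]_d) (f0 : 'rV[R]_d -> R) (F : 'rV[R]_d -> Y)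
    (c : R) :
  continuous f0 -> 0 <= c -> coercive_on Q (penalty_fun K f0 F c) ->
  exists B, 0 <= B /\ forall x, Q x -> - B <= penalty_fun K f0 F c x.
Proof.
move=> cf0 c0 /(coercive_on_bounded 0)[r hr].
have [m hm] := continuous_lower_bound r cf0.
exists `|m|; split=> // x Qx.
have [xle|/ltW] := leP (penalty_fun K f0 F c x) 0; last first.
  by apply: le_trans; rewrite oppr_le0.
apply: le_trans (_ : m <= _); first by rewrite lerNl -normrN ler_norm.
rewrite -[m]addr0 /penalty_fun lerD ?mulr_ge0 ?dist_set_ge0//.
by apply: hm; exact: hr.
Qed.

(** * The linearized constraint map *)

Lemma frechet_remainder_continuous (R : realType) (d : nat)
    (Y : normedModType R) (H : 'rV[R]_d -> Y) (x : 'rV[R]_d) :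
  continuously_frechet_diff H ->
  continuous (fun z : 'rV[R]_d => H x - H z - 'd H z (x - z)).
Proof.
move=> [dH ddH] z0.
have cH : {for z0, continuous H} by exact: differentiable_continuous.
have csub : {for z0, continuous (fun z : 'rV[R]_d => x - z)}.
  exact: (cvgB (cvg_cst x) (@cvg_id _ (nbhs z0))).
have cd0 : {for z0, continuous (fun z : 'rV[R]_d => 'd H z0 (x - z))}.
  by apply: continuous_comp => //; exact: diff_continuous.
suff cd : {for z0, continuous (fun z : 'rV[R]_d => 'd H z (x - z))}.
  exact: (cvgB (cvgB (cvg_cst (H x)) cH) cd).
apply/(@cvgrPdist_le _ _ _ (nbhs z0)) => eps eps0.
(* [N] bounds the norm of [x - z] for [z] within distance 1 of [z0]. *)
pose N := `|x - z0| + 1.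
have N0 : 0 < N by rewrite ltr_wpDl.
have e1 : 0 < eps / 2 by lra.
have e2 : 0 < eps / 2 / N by exact: divr_gt0.
have near1 : \forall z \near z0, `|'d H z0 (x - z0) - 'd H z0 (x - z)| <= eps / 2.
  exact: (@cvgr_dist_le _ _ _ _ (nbhs_filter z0) _ _ cd0 _ e1).
have near2 : \forall z \near z0, `|(x - z0) - (x - z)| <= 1.
  exact: (@cvgr_dist_le _ _ _ _ (nbhs_filter z0) _ _ csub _ ltr01).
near=> z.
(* The first difference moves only the argument, the second only the operator. *)
have -> : 'd H z0 (x - z0) - 'd H z (x - z) =
    ('d H z0 (x - z0) - 'd H z0 (x - z)) - ('d H z (x - z) - 'd H z0 (x - z)).
  by rewrite opprB addrA subrK.
apply: le_trans (ler_normB _ _) _; rewrite [leRHS](splitr eps) lerD//.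
  by near: z; exact: near1.
have h : forall u, `|'d H z u - 'd H z0 u| <= eps / 2 / N * `|u|.
  by near: z; exact: ddH.
apply: le_trans (h _) _.
rewrite -mulrA ler_piMr//; first exact: ltW.
rewrite ler_pdivrMl// mulr1 /N.
have -> : x - z = (x - z0) - ((x - z0) - (x - z)) by rewrite opprB subrKC.
apply: le_trans (ler_normB _ _) _; rewrite lerD2l.
by near: z; exact: near2.
Unshelve. all: by end_near. Qed.

(** Isolates the dependence on [z] in the remainder, which lies in [K] by [cone_convex_gradient]. *)
Lemma lin_mapE (R : realType) (d : nat) (Y : normedModType R)
    (G H : 'rV[R]_d -> Y) (z x : 'rV[R]_d) :
  lin_map G H z x = (G x - H x) + (H x - H z - 'd H z (x - z)).
Proof. by rewrite /lin_map !addrA subrK. Qed.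

(** Subtracting the affine map [A] leaves the convexity gap of [G] unchanged. *)
Lemma lin_map_cone_convex (R : realType) (d : nat) (Y : normedModType R)
    (K : set Y) (G H : 'rV[R]_d -> Y) (z : 'rV[R]_d) :
  cone_convex K G -> cone_convex K (lin_map G H z).
Proof.
move=> hG a x1 x2 a0 a1; have := hG a x1 x2 a0 a1; rewrite /cone_le.
pose A x := H z + 'd H z (x - z).
have lE x : lin_map G H z x = G x - A x by rewrite /lin_map -addrA -opprD.
rewrite !lE; have -> : A (a *: x1 + (1 - a) *: x2) = a *: A x1 + (1 - a) *: A x2.
  rewrite {1}/A; have -> : a *: x1 + (1 - a) *: x2 - z = a *: (x1 - z) + (1 - a) *: (x2 - z).
    by rewrite !scalerBr [RHS]addrACA -opprD -[in RHS]scalerDl subrKC scale1r.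
  rewrite linearD !linearZ /= /A !scalerDr [RHS]addrACA.
  by rewrite -[in RHS]scalerDl subrKC scale1r.
by congr K; rewrite !scalerBr addrACA -opprD opprB addrA subrK.
Qed.

Lemma lin_map_continuous (R : realType) (d : nat) (Y : normedModType R)
    (G H : 'rV[R]_d -> Y) (z : 'rV[R]_d) :
  continuous G -> differentiable H z -> continuous (lin_map G H z).
Proof.
move=> cG dH x.
have cz : {for x, continuous (fun y : 'rV[R]_d => y - z)}.
  exact: (cvgB (@cvg_id _ (nbhs x)) (cvg_cst z)).
have cd : {for x, continuous (fun y : 'rV[R]_d => 'd H z (y - z))}.
  by apply: continuous_comp => //; exact: diff_continuous.
exact: (cvgB (cvgB (cG x) (cvg_cst (H z))) cd).
Qed.

(* For varying [z] the values [lin_map G H z xh] differ by elements of [K - K],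
   so a single point [xh] stays strictly feasible relative to the span of [K]. *)
Lemma slater_set_near (R : realType) (d : nat) (Y : normedModType R)
    (K : set Y) (Q : set 'rV[R]_d) (G H : 'rV[R]_d -> Y) (z0 : 'rV[R]_d) :
  proper_cone K -> finite_dim_cone K -> cone_convex K H ->
  continuously_frechet_diff H -> slater_set K Q G H z0 ->
  exists (xh : 'rV[R]_d) (theta : R), [/\ Q xh, 0 < theta &
    \forall z \near z0, forall s, K s -> s <> 0 ->
      K (- ((theta / `|s|) *: s) - lin_map G H z xh)].
Proof.
move=> hK hfin hH hH1 [_ /nbhs_normP[delta /= delta0 hdelta]].
have [e [r [Ke r0 he]]] := cone_relative_interior hK hfin.
(* This choice puts [- (eta *: e)] inside the ball of radius [delta], so it is attained at some [xh]
   up to an element of [K]. *)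
pose eta := delta / (2 * (`|e| + 1)).
have e1 : 0 < `|e| + 1 by rewrite ltr_wpDl.
have eta0 : 0 < eta by rewrite divr_gt0// mulr_gt0.
have [|xh Qxh [k Kk hk]] := hdelta (- (eta *: e)).
  rewrite /= sub0r opprK normrZ gtr0_norm// /eta mulrAC ltr_pdivrMr ?mulr_gt0//.
  by rewrite ltr_pM2l//; have := normr_ge0 e; lra.
exists xh, (eta / 2 * r); split => //; first by rewrite mulr_gt0//; lra.
pose a z := H xh - H z - 'd H z (xh - z).
have Ka z : K (a z) by apply: cone_convex_gradient => //; case: hH1.
have ca : {for z0, continuous a} by exact: frechet_remainder_continuous.
have reta0 : 0 < eta / 2 * r by rewrite mulr_gt0//; lra.
have eta2 : 0 < eta / 2 by lra.
have := @cvgr_dist_le _ _ _ _ (nbhs_filter z0) _ _ ca _ reta0.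
apply: filterS => z hz s Ks s0.
have sn0 : 0 < `|s| by rewrite normr_gt0; exact/eqP.
(* One half of [eta *: e] absorbs the variation of the remainder in [z]; in [h2] the other half
   provides the margin along [s], whence [theta] is [eta / 2 * r]. *)
have h1 : K (eta / 2 *: e + (a z0 - a z)).
  have -> : eta / 2 *: e + (a z0 - a z) =
      (eta / 2) *: (e + ((eta / 2)^-1 *: a z0 - (eta / 2)^-1 *: a z)).
    by rewrite -scalerBr scalerDr scalerA divff ?scale1r// gt_eqF.
  apply: cone_scale => //; first exact: ltW.
  apply: he; try by apply: cone_scale => //; rewrite invr_ge0 ltW.
  by rewrite -scalerBr normrZ gtr0_norm ?invr_gt0// ler_pdivrMl.
have h2 : K ((eta / 2) *: (e + (0 - (r / `|s|) *: s))).
  apply: cone_scale => //; first exact: ltW.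
  apply: he; first exact: cone0.
    by apply: cone_scale => //; rewrite divr_ge0// ltW.
  by rewrite sub0r normrN normrZ ger0_norm ?divr_ge0 ?(ltW r0)// divfK// gt_eqF.
have := cone_add hK (cone_add hK h1 h2) Kk.
congr K; rewrite lin_mapE -/(a z).
have -> : k = - (eta *: e) - ((G xh - H xh) + a z0).
  by rewrite -hk lin_mapE -/(a z0) addrAC subrr add0r.
rewrite sub0r scalerBr scalerA mulrA.
have -> : eta *: e = (eta / 2) *: e + (eta / 2) *: e by rewrite -scalerDl -splitr.
move: (a z) (a z0) (G xh - H xh) => b b0 p.
rewrite [X in X + _ = _]addrACA [LHS]addrACA subrr add0r (addrC p) opprD.
by rewrite -(addrA b0) [LHS]addrACA subrr add0r (addrC (- b)) -addrA -opprD (addrC b).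
Qed.

(** * The subproblem objective and the slack *)

Lemma dotrvD (R : realType) (d : nat) (v x y : 'rV[R]_d) :
  dotrv v (x + y) = dotrv v x + dotrv v y.
Proof.
by rewrite /dotrv -big_split; apply: eq_bigr => i _; rewrite mxE mulrDr.
Qed.

Lemma dotrvZ (R : realType) (d : nat) (a : R) (v x : 'rV[R]_d) :
  dotrv v (a *: x) = a * dotrv v x.
Proof.
by rewrite /dotrv mulr_sumr; apply: eq_bigr => i _; rewrite mxE mulrCA.
Qed.

Lemma dotrvB (R : realType) (d : nat) (v x y : 'rV[R]_d) :
  dotrv v (x - y) = dotrv v x - dotrv v y.
Proof. by rewrite dotrvD -scaleN1r dotrvZ mulN1r. Qed.

Lemma dotrv_continuous (R : realType) (d : nat) (v : 'rV[R]_d) :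
  continuous (dotrv v).
Proof.
have := @lincomb_continuous R R d (fun j => v 0 j).
suff -> : lincomb (fun j => v 0 j) = dotrv v by [].
by apply/funext => x; apply: eq_bigr => j _; rewrite mulrC.
Qed.

Lemma subproblem_obj_convex (R : realType) (d : nat) (g : 'rV[R]_d -> R)
    (v x y : 'rV[R]_d) (a : R) :
  convex_function setT g -> 0 <= a -> a <= 1 ->
  subproblem_obj g v (a *: x + (1 - a) *: y) <=
  a * subproblem_obj g v x + (1 - a) * subproblem_obj g v y.
Proof.
move=> cg a0 a1; rewrite /subproblem_obj dotrvD !dotrvZ.
by have := convex_function_comb x y cg a0 a1; lra.
Qed.

(* Reflecting [xh] through [z] bounds [- <v, xh>] by values of [h], so the bound
   is uniform in the subgradient [v]. *)
Lemma subproblem_obj_gap (R : realType) (d : nat) (g h : 'rV[R]_d -> R)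
    (z v xh x : 'rV[R]_d) : subdifferential h z v ->
  subproblem_obj g v xh - subproblem_obj g v x <=
  g xh + h (2 *: z - xh) - 2 * h z - (g x - h x).
Proof.
move=> hv; have := hv x; have := hv (2 *: z - xh); rewrite /subproblem_obj.
by rewrite !dotrvB dotrvZ; lra.
Qed.

Lemma subproblem_obj_ge (R : realType) (d : nat) (g h : 'rV[R]_d -> R)
    (z v x : 'rV[R]_d) : subdifferential h z v ->
  g x - h x + (h z - dotrv v z) <= subproblem_obj g v x.
Proof. by move=> hv; have := hv x; rewrite /subproblem_obj dotrvB; lra. Qed.

(** Adding the remainder, which lies in [K], gives [s - F x] in [K]; thus [F x - s] is a point of
    [- K] at distance |s| from [F x]. *)
Lemma dist_set_le_slack (R : realType) (d : nat) (Y : normedModType R)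
    (K : set Y) (G H : 'rV[R]_d -> Y) (z x : 'rV[R]_d) (s : Y) :
  proper_cone K -> cone_convex K H -> differentiable H z ->
  cone_le K (lin_map G H z x) s ->
  dist_set (G x - H x) (neg_set K) <= `|s|.
Proof.
move=> hK hH dH hs.
have hF : K (s - (G x - H x)).
  have := cone_add hK hs (cone_convex_gradient x hK hH dH).
  congr K; rewrite lin_mapE; move: (G x - H x) (H x - H z - _) => p a.
  by rewrite opprD addrA subrK.
apply: le_trans (dist_set_le (G x - H x) (_ : neg_set K (G x - H x - s))) _.
  by exists (s - (G x - H x)) => //; rewrite opprB.
by rewrite opprB subrKC.
Qed.

(** * Removing the slack at a profit *)

(** The two thresholds on [mu] together give M + B + c |s| < mu kappa (theta + |s|): one covers the
    constant term, the other the term in |s|. *)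
Lemma penalization_descent (R : realType) (d : nat) (Y : normedModType R)
    (g0 h0 : 'rV[R]_d -> R) (K : set Y) (G H : 'rV[R]_d -> Y)
    (Q : set 'rV[R]_d) (t0 : {linear Y -> R}) (c kappa B theta M mu : R)
    (z v xh x : 'rV[R]_d) (s : Y) :
  proper_cone K -> convex_set Q -> convex_function setT g0 ->
  cone_convex K G -> cone_convex K H -> differentiable H z ->
  (forall y, K y -> kappa * `|y| <= t0 y) -> 0 <= c -> 0 < theta ->
  (forall y, Q y ->
    - B <= penalty_fun K (fun x => g0 x - h0 x) (fun x => G x - H x) c y) ->
  Q xh -> (forall y, K y -> y <> 0 ->
    K (- ((theta / `|y|) *: y) - lin_map G H z xh)) ->
  g0 xh + h0 (2 *: z - xh) - 2 * h0 z <= M ->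
  0 <= mu -> M + B < mu * kappa * theta -> c <= mu * kappa ->
  subdifferential h0 z v -> Q x -> K s -> s <> 0 ->
  cone_le K (lin_map G H z x) s ->
  exists2 x', subproblem_feasible K Q G H z x' &
    subproblem_obj g0 v x' < subproblem_obj g0 v x + mu * t0 s.
Proof.
move=> hK cQ cg hG hH dH hkappa c0 theta0 hB Qxh hxh hM mu0 hmu1 hmu2 hv Qx Ks s0 xs.
have sn0 : 0 < `|s| by rewrite normr_gt0; exact/eqP.
have ts0 : 0 < theta + `|s| by exact: addr_gt0.
(* With this fraction the margin of [xh] along [s], weighted by [l], exactly cancels the remaining
   slack [(1 - l) *: s]. *)
pose l := `|s| / (theta + `|s|).
have l0 : 0 <= l by rewrite divr_ge0// ltW.
have l1 : l <= 1 by rewrite ler_pdivrMr// mul1r lerDr ltW.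
have l1' : 0 <= 1 - l by rewrite subr_ge0.
have le : l * (theta / `|s|) = 1 - l.
  by rewrite /l; field; rewrite !gt_eqF.
exists (l *: xh + (1 - l) *: x).
  split; last exact: convex_set_comb.
  have := cone_add hK (cone_add hK (cone_scale hK l0 (hxh _ Ks s0))
    (cone_scale hK l1' xs)) (lin_map_cone_convex H z hG xh x l0 l1).
  rewrite /cone_le sub0r; congr K.
  rewrite !scalerBr scalerN scalerA le.
  rewrite [X in X + _ = _]addrACA addNr add0r -opprD addrA addNr add0r.
  by [].
have := subproblem_obj_convex v xh x cg l0 l1.
have := subproblem_obj_gap g0 xh x hv.
have := hB _ Qx; rewrite /penalty_fun.
have := ler_wpM2l c0 (dist_set_le_slack hK hH dH xs).
have := ler_wpM2l mu0 (hkappa _ Ks).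
set D := dist_set _ _; set p := subproblem_obj g0 v => t1 t2 t3 t4 t5.
(* The gap is at most [M] minus the value of [g0 - h0] at [x], which the penalty bound keeps above -
   B - c |s|. *)
have t6 : p xh - p x <= M + B + c * `|s| by lra.
have t7 : c * `|s| <= mu * kappa * `|s| by rewrite ler_pM2r.
have t8 : p xh - p x < mu * kappa * (theta + `|s|) by lra.
have t9 : l * (p xh - p x) < mu * (kappa * `|s|).
  rewrite /l mulrAC ltr_pdivrMr//.
  rewrite (_ : mu * (kappa * `|s|) * (theta + `|s|) = `|s| * (mu * kappa * (theta + `|s|))); last by ring.
  by rewrite ltr_pM2l.
lra.
Qed.

(** * Solvability and exactness *)

(** On the feasible set the distance term vanishes, so the objective dominates the penalty function
    up to a constant and its sublevel sets are bounded. *)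
Lemma subproblem_solvable (R : realType) (d : nat) (Y : normedModType R)
    (g0 h0 : 'rV[R]_d -> R) (K : set Y) (G H : 'rV[R]_d -> Y)
    (Q : set 'rV[R]_d) (c : R) (z v : 'rV[R]_d) :
  proper_cone K -> closed Q -> continuous g0 -> continuous G ->
  cone_convex K H -> differentiable H z -> 0 <= c ->
  coercive_on Q
    (penalty_fun K (fun x => g0 x - h0 x) (fun x => G x - H x) c) ->
  subdifferential h0 z v -> subproblem_feasible K Q G H z !=set0 ->
  exists x, global_solution (subproblem_feasible K Q G H z)
    (subproblem_obj g0 v) x.
Proof.
move=> hK clQ cg cG hH dH c0 hcoer hv [x0 Sx0].
have [r hr] := coercive_on_bounded
  (subproblem_obj g0 v x0 - (h0 z - dotrv v z)) hcoer.
apply: (@coercive_minimum _ _ _ _ x0 r) => //.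
- apply: closedI => //.
  apply: (@closed_comp _ _ (fun x => 0 - lin_map G H z x) K); last by case: hK.
  by move=> x _; exact: (cvgB (cvg_cst 0) (lin_map_continuous cG dH (x:=x))).
- by move=> x; exact: (cvgB (cg x) (dotrv_continuous (x:=x))).
- move=> x [xs Qx] xx0; apply: hr => //; rewrite /penalty_fun.
  have := ler_wpM2l c0 (dist_set_le_slack hK hH dH xs).
  rewrite normr0 mulr0.
  by have := subproblem_obj_ge g0 x hv; lra.
Qed.

Theorem corollary7 (R : realType) (d : nat) (Y : completeNormedModType R)
    (g0 h0 : 'rV[R]_d -> R) (K : set Y) (G H : 'rV[R]_d -> Y)
    (Q : set 'rV[R]_d) (t0 : {linear Y -> R})
    (hg0 : closed_convex_fun g0) (hh0 : closed_convex_fun h0)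
    (hK : proper_cone K)
    (hG : cone_convex K G) (hH : cone_convex K H)
    (hH1 : continuously_frechet_diff H)
    (hQcl : closed Q) (hQcv : convex_set Q)
    (ht0 : dual_cone_gt0 K t0)
    (hKfin : finite_dim_cone K)
    (hcoer : exists c : R, 0 <= c /\
       coercive_on Q
         (penalty_fun K (fun x => g0 x - h0 x) (fun x => G x - H x) c)) :
  forall D0 : set 'rV[R]_d, compact D0 -> D0 `<=` slater_set K Q G H ->
  exists mu_star : R, 0 <= mu_star /\
    forall mu : R, mu_star <= mu ->
    forall z v : 'rV[R]_d, D0 z -> subdifferential h0 z v ->
      (exists xs : 'rV[R]_d * Y,
         global_solution (penalized_feasible K Q G H z)
           (penalized_obj g0 t0 v mu) xs) /\
      (forall (x : 'rV[R]_d) (s : Y),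
         global_solution (penalized_feasible K Q G H z)
           (penalized_obj g0 t0 v mu) (x, s) <->
         s = 0 /\
         global_solution (subproblem_feasible K Q G H z)
           (subproblem_obj g0 v) x).
Proof.
move=> D0 cD0 D0s.
case: hcoer => c [c0 hc].
have cg0 : continuous g0 by apply: convex_function_continuous; case: hg0.
have ch0 : continuous h0 by apply: convex_function_continuous; case: hh0.
have cG : continuous G by exact: cone_convex_continuous hK hKfin ht0 hG.
have dH z : differentiable H z by case: hH1.
have [kappa kappa0 hkappa] := dual_cone_gt0_coercive hK hKfin ht0.
have cf0 : continuous (fun x => g0 x - h0 x).
  by move=> x; exact: (cvgB (cg0 x) (ch0 x)).
have [B [B0 hB]] := penalty_fun_lower_bound cf0 c0 hc.
(* Every pair with nonzero slack is strictly beaten by a feasible point without slack. *)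
pose P (mu : R) z := forall v x s, subdifferential h0 z v -> Q x -> K s ->
  s <> 0 -> cone_le K (lin_map G H z x) s ->
  exists2 x', subproblem_feasible K Q G H z x' &
    subproblem_obj g0 v x' < subproblem_obj g0 v x + mu * t0 s.
(* The covering form of compactness merges the local thresholds around each [z0] into a single
   one. *)
have : \forall mu \near +oo, D0 `<=` P mu.
  move/compact_near_coveringP : cD0; apply => z0 /D0s Sz0.
  have [xh [theta [Qxh theta0 hxh]]] := slater_set_near hK hKfin hH hH1 Sz0.
  (* This is the bound of [subproblem_obj_gap]; by continuity it stays below [m z0 + 1] near [z0],
     whatever the subgradient. *)
  pose m (z : 'rV[R]_d) := g0 xh + h0 (2 *: z - xh) - 2 * h0 z.
  have cm : {for z0, continuous m}.
    have cr : {for z0, continuous (fun z : 'rV[R]_d => 2 *: z - xh)}.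
      exact: (cvgB (@scaler_continuous _ _ 2 z0) (cvg_cst xh)).
    have ch : {for z0, continuous (fun z : 'rV[R]_d => h0 (2 *: z - xh))}.
      by apply: continuous_comp => //; exact: ch0.
    exact: (cvgB (cvgD (cvg_cst (g0 xh)) ch) (cvgMr (a := 2) (ch0 z0))).
  have hm : \forall z \near z0, `|m z0 - m z| <= 1.
    exact: (@cvgr_dist_le _ _ _ _ (nbhs_filter z0) _ _ cm _ ltr01).
  have hmu : \forall mu \near +oo,
      [/\ 0 <= mu, (m z0 + 1 + B) / (kappa * theta) < mu & c / kappa <= mu].
    near=> mu; split; near: mu.
    - exact: nbhs_pinfty_ge (num_real _).
    - exact: nbhs_pinfty_gt (num_real _).
    - exact: nbhs_pinfty_ge (num_real _).
  exists ([set z | `|m z0 - m z| <= 1 /\ forall s, K s -> s <> 0 ->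
      K (- ((theta / `|s|) *: s) - lin_map G H z xh)],
    [set mu | [/\ 0 <= mu, (m z0 + 1 + B) / (kappa * theta) < mu &
      c / kappa <= mu]]).
    by split=> //=; exact: filterI.
  move=> [z mu] /= [[mz hz] [mu0 mu1 mu2]] v x s.
  apply: (penalization_descent (M := m z0 + 1) hK hQcv _ hG hH (dH z) hkappa c0 theta0 hB Qxh hz) => //.
  - by case: hg0.
  - by move: mz; rewrite ler_norml => /andP[+ _]; rewrite -/(m z); lra.
  - by move: mu1; rewrite ltr_pdivrMr ?mulr_gt0// mulrA.
  - by move: mu2; rewrite ler_pdivrMr.
move=> [mu1 [_ hmu1]].
(* A neighbourhood of +oo only covers values strictly above [mu1], hence the [+ 1]. *)
exists (Num.max 0 (mu1 + 1)); split; first by rewrite le_max lexx.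
move=> mu; rewrite ge_max => /andP[mu0 hmu] z v D0z hv.
have hP : P mu z by apply: hmu1 => //; apply: lt_le_trans hmu; rewrite ltrDl.
have objE x s : penalized_obj g0 t0 v mu (x, s) = subproblem_obj g0 v x + mu * t0 s.
  by [].
have obj0 x : penalized_obj g0 t0 v mu (x, 0) = subproblem_obj g0 v x.
  by rewrite objE linear0 mulr0 addr0.
have feas0 x : penalized_feasible K Q G H z (x, 0) <-> subproblem_feasible K Q G H z x.
  split=> [[]//|[xs Qx]]; split=> //=.
  by rewrite /cone_le subrr; exact: cone0.
have sol0 x : global_solution (subproblem_feasible K Q G H z) (subproblem_obj g0 v) x ->
    global_solution (penalized_feasible K Q G H z) (penalized_obj g0 t0 v mu) (x, 0).
  move=> [Sx xmin]; split; first exact/feas0.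
  move=> [y s] [/= ys]; rewrite /cone_le subr0 => Ks Qy; rewrite obj0.
  have [s0|/eqP s0] := eqVneq s 0.
    by rewrite s0 obj0; apply: xmin; split=> //; rewrite -s0.
  have [x' Sx' /ltW hx'] := hP v y s hv Qy Ks s0 ys.
  exact: le_trans (xmin _ Sx') hx'.
split.
  (* The interior point 0 belongs to the set itself, which yields a feasible point. *)
  have [_ /nbhs_singleton[x Qx [k Kk hk]]] := D0s _ D0z.
  have Sx : subproblem_feasible K Q G H z x.
    by split=> //; rewrite /cone_le -hk addrAC subrr add0r.
  have [xs hxs] := subproblem_solvable hK hQcl cg0 cG hH (dH z) c0 hc hv (ex_intro _ x Sx).
  by exists (xs, 0); exact: sol0.
move=> x s; split=> [[[/= xs + Qx] xmin]|[-> /sol0//]].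
rewrite /cone_le subr0 => Ks.
(* A nonzero slack contradicts optimality, since [P] provides a strictly better pair with zero
   slack. *)
have [s0|/eqP s0] := eqVneq s 0; last first.
  have [x' /feas0 Sx' hx'] := hP v x s hv Qx Ks s0 xs.
  by have := xmin _ Sx'; rewrite obj0 objE leNgt hx'.
split=> //; split=> [|y /feas0 Sy]; first by split=> //; rewrite -s0.
by have := xmin _ Sy; rewrite s0 !obj0.
Unshelve. all: by end_near. Qed.
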